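(* Let $n,k,m\ge 1$ be integers. There exists a sequence of $n$ elements of $\mathbb{Z}^k$ that is $m$-th evaluation distinct and $M$-bounded for some $M$ satisfying $$M\leq m\cdot 4^{n/k}.$$
   Context: Here $[1,n]=\{1,\ldots,n\}$. For a real number $M$, a sequence $\Sigma=(a_1,\ldots,a_n)$ in $\mathbb{Z}^k$ is $M$-bounded if $a_i\in[0,M]^k$ for every $i$. For $A\subseteq[1,n]$, $$e^m_{\Sigma}(A)=\sum_{\{i_1<\cdots<i_m\}\subseteq A}a_{i_1}\cdots a_{i_m}\in\mathbb{Z}^k,$$ where products of vectors are taken coordinatewise, with the convention $e^m_\Sigma(A)=0$ if $|A|<m$. The sequence $\Sigma$ is $m$-th evaluation distinct if $e^m_\Sigma(A_1)\ne e^m_\Sigma(A_2)$ for all distinct $A_1,A_2\subseteq[1,n]$ of size at least $m$. *)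

(* Defs.v *)
From HB Require Import structures.
From mathcomp Require Import all_boot all_order all_algebra.
From mathcomp Require Import all_classical all_reals all_analysis.

Set Implicit Arguments.
Unset Strict Implicit.
Unset Printing Implicit Defensive.

Import Order.TTheory GRing.Theory Num.Theory.
Local Open Scope ring_scope.

(* A sequence of n elements of Z^k is an n-tuple of row vectors; it is indexed
   by 'I_n = {0, ..., n-1} instead of {1, ..., n}. *)

Definition bounded_seq (R : realType) (n k : nat) (M : R)
    (s : n.-tuple 'rV[int]_k) : Prop :=
  forall (i : 'I_n) (j : 'I_k), 0 <= ((tnth s i 0 j)%:~R : R) <= M.

(* The index sets {i_1 < ... < i_m} are the m-element subsets of A, and the
   products of vectors are coordinatewise. The sum is empty, hence 0, when
   #|A| < m. *)
Definition evaluation (n k m : nat) (s : n.-tuple 'rV[int]_k)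
    (A : {set 'I_n}) : 'rV[int]_k :=
  \sum_(I : {set 'I_n} | (I \subset A) && (#|I| == m))
    \row_(j < k) \prod_(i in I) tnth s i 0 j.

Definition evaluation_distinct (n k m : nat) (s : n.-tuple 'rV[int]_k) : Prop :=
  forall A1 A2 : {set 'I_n}, (m <= #|A1|)%N -> (m <= #|A2|)%N -> A1 <> A2 ->
    evaluation m s A1 <> evaluation m s A2.

(* Main.v *)
(** For [A1 <> A2], both of size at least [m], the difference of the two [m]-th
    evaluations is in each coordinate a nonzero multilinear polynomial of degree
    at most [m].  By Schwartz-Zippel it vanishes for a fraction at most [m / S]
    of the points of [{0, ..., S-1}^n], hence in all [k] coordinates at once for
    a fraction at most [(m / S)^k].  When [S = floor (m 4^(n/k)) + 1] this is
    less than [4^-n], and there are only [4^n] pairs [(A1, A2)]. *)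
Require Import Defs.
From HB Require Import structures.
From mathcomp Require Import all_boot all_order all_algebra.
From mathcomp Require Import all_classical all_reals all_analysis.

Set Implicit Arguments.
Unset Strict Implicit.
Unset Printing Implicit Defensive.

Import Order.TTheory GRing.Theory Num.Theory.
Local Open Scope ring_scope.

Definition multilinear (D : comNzRingType) (T : finType) (c : {set T} -> D)
    (x : T -> D) : D :=
  \sum_(I : {set T}) c I * \prod_(i in I) x i.

(** Both new coefficient families vanish on every set containing [i], so by [multilinear_indep] the
    polynomial is affine in [x i], with intercept and slope independent of [x i]. The slope collects
    the sets containing [i] through the bijection [I :\ i] to [I]. *)
Lemma multilinear_split (D : comNzRingType) (T : finType) (c : {set T} -> D)
    (i : T) (x : T -> D) :
  multilinear c x =
    multilinear (fun I => if i \in I then 0 else c I) x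
    + x i * multilinear (fun I => if i \in I then 0 else c (i |: I)) x.
Proof.
rewrite /multilinear (bigID (fun I : {set T} => i \in I)) /= addrC.
congr (_ + _).
  rewrite [RHS](bigID (fun I : {set T} => i \in I)) /=.
  rewrite [X in _ = X + _]big1 ?add0r; last by move=> I ->; rewrite mul0r.
  by apply: eq_bigr => I /negbTE ->.
rewrite [X in _ = _ * X](bigID (fun I : {set T} => i \in I)) /=.
rewrite [X in _ = _ * (X + _)]big1 ?add0r; last by move=> I ->; rewrite mul0r.
rewrite big_distrr /= (reindex_onto (fun I => i |: I) (fun I => I :\ i)) /=;
  last by move=> I; apply: finset.setD1K.
have setU1E (I : {set T}) :
    (i \in i |: I) && ((i |: I) :\ i == I) = (i \notin I).
  rewrite setU11 /=; apply/eqP/idP => [<- | /setU1K //].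
  by rewrite !inE eqxx.
rewrite (eq_bigl _ _ setU1E); apply: eq_bigr => I iI.
by rewrite (negbTE iI) big_setU1 //= mulrCA.
Qed.

Lemma multilinear_indep (D : comNzRingType) (T : finType) (c : {set T} -> D)
    (i : T) (x y : T -> D) :
  (forall I : {set T}, i \in I -> c I = 0) -> (forall j, j != i -> x j = y j) ->
  multilinear c x = multilinear c y.
Proof.
move=> ci xy; apply: eq_bigr => I _; have [/ci -> | iI] := boolP (i \in I).
  by rewrite !mul0r.
by congr (_ * _); apply: eq_bigr => j jI; apply: xy; apply: contraNneq iI => <-.
Qed.

(** Induction on [d], writing the polynomial as q + x_i r with r nonzero of degree at most [d]. The
    zeros of r are counted by induction; where r does not vanish, the other variables leave at most
    one root for x_i. *)
Lemma schwartz_zippel (D : idomainType) (T U : finType) (v : U -> D) (d : nat)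
    (c : {set T} -> D) :
  injective v -> (exists I, c I != 0) -> (forall I, c I != 0 -> (#|I| <= d)%N) ->
  (#|[set x : {ffun T -> U} | multilinear c (v \o x) == 0%R]| * #|U|
     <= d * #|{ffun T -> U}|)%N.
Proof.
move=> v_inj; elim: d c => [|d IHd] c [I0 cI0] deg_c.
  rewrite leqn0 muln_eq0 cards_eq0; apply/orP; left; apply/eqP/setP => x.
  rewrite !inE; apply/negbTE.
  have I00 : I0 = finset.set0.
    by apply/eqP; rewrite -cards_eq0 -leqn0; apply: deg_c.
  rewrite /multilinear (bigD1 finset.set0) //= big_set0 mulr1 big1 ?addr0 -?I00 //.
  move=> I; rewrite I00 => I_neq0; have [-> | /deg_c] := eqVneq (c I) 0.
    by rewrite mul0r.
  by rewrite leqn0 cards_eq0 (negbTE I_neq0).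
(* If only the empty set carries a coefficient, there is no variable to split off, but the degree is
   0 and the induction hypothesis applies to [c] itself. *)
have [[I [cI I_neq0]] | small] :=
    pselect (exists I : {set T}, c I != 0 /\ I != finset.set0); last first.
  apply: (leq_trans (IHd c _ _)); last by rewrite leq_mul2r leqnSn orbT.
    by exists I0.
  move=> I cI; suff /eqP -> : I == finset.set0 by rewrite cards0.
  by apply/negPn/negP => I_neq0; apply: small; exists I.
have [i iI] := set0Pn _ I_neq0.
pose q (I : {set T}) := if i \in I then 0 else c I.
pose r (I : {set T}) := if i \in I then 0 else c (i |: I).
pose Z (f : {set T} -> D) :=
  [set x : {ffun T -> U} | multilinear f (v \o x) == 0].
rewrite -/(Z c); pose W := Z c :\: Z r.
have Zr_le : (#|Z r| * #|U| <= d * #|{ffun T -> U}|)%N.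
  apply: IHd; first by exists (I :\ i); rewrite /r !inE eqxx /= finset.setD1K.
  move=> J; rewrite /r; case: ifP => [_ | iJ]; first by rewrite eqxx.
  by move/deg_c; rewrite cardsU1 iJ.
(* [x] in [W] is determined by its values off [i], so replacing [x i] by an
   arbitrary value is injective on [W * U]. *)
have W_le : (#|W| * #|U| <= #|{ffun T -> U}|)%N.
  pose upd (p : {ffun T -> U} * U) : {ffun T -> U} :=
    [ffun j => if j == i then p.2 else p.1 j].
  rewrite -cardsT -finset.cardsT -cardsX -(card_in_imset (f := upd)).
    exact/subset_leq_card/finset.subsetT.
  move=> [x a] [y b]; rewrite !inE /= !andbT => /andP[rx cx] /andP[_ cy] /ffunP E.
  have ab : a = b by have := E i; rewrite !ffunE eqxx.
  have off j : j != i -> x j = y j.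
    by move=> ji; have := E j; rewrite !ffunE (negbTE ji).
  have voff j : j != i -> (v \o x) j = (v \o y) j by move=> /off /= ->.
  rewrite ab; congr (_, _); apply/ffunP => j.
  have [-> | /off //] := eqVneq j i; apply: v_inj.
  move: cx cy; rewrite !(multilinear_split c i) -/q -/r => /eqP cx /eqP cy.
  have q0 (J : {set T}) : i \in J -> q J = 0 by rewrite /q => ->.
  have r0 (J : {set T}) : i \in J -> r J = 0 by rewrite /r => ->.
  (* The points [x] and [y] share the values of q and r, so q + x_i r = q + y_i r, and r, nonzero at
     [x], cancels. *)
  move: cx; rewrite -cy -(multilinear_indep q0 voff) -(multilinear_indep r0 voff).
  by move/addrI/(mulIf rx).
apply: (@leq_trans ((#|Z r| + #|W|) * #|U|)).
  rewrite leq_mul2r; apply/orP; right.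
  rewrite -(cardsID (Z r) (Z c)) leq_add2r.
  exact/subset_leq_card/finset.subsetIr.
by rewrite mulnDl mulSn addnC leq_add.
Qed.

Lemma exists_subset_card_mem (T : finType) (A : {set T}) (x : T) (m : nat) :
  x \in A -> (0 < m <= #|A|)%N ->
  exists I : {set T}, [/\ x \in I, I \subset A & #|I| = m].
Proof.
move=> xA /andP[m_gt0 mA]; have mA' : (m.-1 <= #|A :\ x|)%N.
  by move: mA; rewrite (cardsD1 x) xA; case: m m_gt0.
have /card_gt0P[B] :
    (0 < #|[set B : {set T} | B \subset A :\ x & #|B| == m.-1]|)%N.
  by rewrite cards_draws bin_gt0.
rewrite inE => /andP[BA /eqP cardB]; exists (x |: B); split.
- exact: setU11.
- by rewrite finset.subUset finset.sub1set xA (fintype.subset_trans BA) // finset.subD1set.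
- rewrite cardsU1 cardB; have /negbTE -> : x \notin B.
    by apply/negP => /(fintype.subsetP BA); rewrite !inE eqxx.
  by rewrite add1n prednK.
Qed.

(** The coefficient of the monomial of [I] in the difference of the two [m]-th evaluations, which
    thus becomes a single sum over all sets. *)
Definition evaluation_coef (D : pzRingType) (T : finType) (m : nat)
    (A1 A2 I : {set T}) : D :=
  ((I \subset A1) && (#|I| == m))%:R - ((I \subset A2) && (#|I| == m))%:R.

(** Up to exchanging the sets, some x lies in [A1] but not in [A2]. An [m]-subset of [A1] through x
    is not contained in [A2], so its coefficient is 1, or -1 after the exchange. *)
Lemma evaluation_coef_neq0 (D : nzRingType) (T : finType) (m : nat)
    (A1 A2 : {set T}) :
  (0 < m)%N -> (m <= #|A1|)%N -> (m <= #|A2|)%N -> A1 <> A2 ->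
  exists I, evaluation_coef D m A1 A2 I != 0.
Proof.
move=> m_gt0 m1 m2 /eqP A12.
have aux (B1 B2 : {set T}) : (m <= #|B1|)%N -> ~~ (B1 \subset B2) ->
    exists I : {set T}, [/\ I \subset B1, ~~ (I \subset B2) & #|I| == m].
  move=> mB1 /fintype.subsetPn[x xB1 xB2].
  have [|I [xI IB1 cardI]] := @exists_subset_card_mem T B1 x m xB1.
    by rewrite m_gt0.
  exists I; split; rewrite ?cardI //.
  by apply/negP => /fintype.subsetP /(_ x xI); apply/negP.
move: A12; rewrite finset.eqEsubset negb_and => /orP[/(aux _ _ m1) | /(aux _ _ m2)].
  move=> [I [I1 /negbTE I2 cardI]]; exists I.
  by rewrite /evaluation_coef I1 I2 cardI subr0 oner_eq0.
move=> [I [I2 /negbTE I1 cardI]]; exists I.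
by rewrite /evaluation_coef I1 I2 cardI sub0r oppr_eq0 oner_eq0.
Qed.

Lemma evaluation_coef_deg (D : pzRingType) (T : finType) (m : nat)
    (A1 A2 I : {set T}) :
  evaluation_coef D m A1 A2 I != 0 -> (#|I| <= m)%N.
Proof.
rewrite /evaluation_coef; have [-> // | _] := eqVneq #|I| m.
by rewrite !andbF subrr eqxx.
Qed.

Lemma evaluation_eq_multilinear (n k m : nat) (s : n.-tuple 'rV[int]_k)
    (A1 A2 : {set 'I_n}) (j : 'I_k) :
  evaluation m s A1 = evaluation m s A2 ->
  multilinear (evaluation_coef int m A1 A2) (fun i => tnth s i 0 j) = 0.
Proof.
move=> /rowP/(_ j)/eqP; rewrite -subr_eq0 /evaluation !summxE => /eqP <-.
rewrite [X in _ = X - _]big_mkcond [X in _ = _ - X]big_mkcond -sumrB.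
apply: eq_bigr => I _; rewrite !mxE /evaluation_coef mulrBl.
by congr (_ - _); case: ifP; rewrite ?mul1r ?mul0r.
Qed.

Lemma exists_evaluation_distinct (n k m S : nat) :
  (0 < k)%N -> (0 < m)%N -> (m ^ k * 4 ^ n < S ^ k)%N ->
  exists2 s : n.-tuple 'rV[int]_k, evaluation_distinct m s &
    forall i j, exists2 a : nat, (a < S)%N & tnth s i 0 j = a%:Z.
Proof.
move=> k_gt0 m_gt0 S_large; pose X := {ffun 'I_n -> 'I_S}.
pose v (a : 'I_S) : int := (val a)%:Z.
have v_inj : injective v by move=> a b [] /val_inj.
pose Z (p : {set 'I_n} * {set 'I_n}) : {set X} :=
  [set x : X | multilinear (evaluation_coef int m p.1 p.2) (v \o x) == 0].
pose admissible (p : {set 'I_n} * {set 'I_n}) :=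
  [&& (m <= #|p.1|)%N, (m <= #|p.2|)%N & p.1 != p.2].
have Z_le p : admissible p -> (#|Z p| * S <= m * #|X|)%N.
  move=> /and3P[m1 m2 /eqP p12]; rewrite -{1}[S in (_ * S)%N]card_ord.
  apply: schwartz_zippel => //; first exact: evaluation_coef_neq0.
  exact: evaluation_coef_deg.
(* A family [y] holds one point of [X] per coordinate. It fails for [p] when all [k] points lie in
   [Z p], which happens for [#|Z p| ^ k] families. *)
pose bad : {set {ffun 'I_k -> X}} :=
  \bigcup_(p | admissible p) [set y in ffun_on (mem (Z p))].
have Sk_gt0 : (0 < S ^ k)%N by apply: leq_ltn_trans S_large.
have X_gt0 : (0 < #|X| ^ k)%N.
  rewrite card_ffun !card_ord expn_gt0 expn_gt0.
  by move: Sk_gt0; rewrite expn_gt0 => /orP[-> // | ->]; rewrite orbT.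
have bad_lt : (#|bad| < #|{ffun 'I_k -> X}|)%N.
  rewrite card_ffun card_ord -(ltn_pmul2r Sk_gt0).
  have bad_le : (#|bad| <= \sum_(p | admissible p) #|Z p| ^ k)%N.
    rewrite /bad; elim/big_rec2: _ => [|p B t _ IH]; first by rewrite cards0.
    apply: (leq_trans (leq_card_setU _ _)).
    by rewrite leq_add // cardsE card_ffun_on card_ord.
  (* Union bound, multiplied by [S ^ k] to avoid fractions: each of the at most [4 ^ n] admissible
     pairs contributes [(#|Z p| * S) ^ k], at most [(m * #|X|) ^ k]. *)
  apply: (@leq_ltn_trans (4 ^ n * (m * #|X|) ^ k)%N); last first.
    by rewrite expnMn mulnA [leqRHS]mulnC ltn_pmul2r // mulnC.
  apply: (leq_trans (leq_mul bad_le (leqnn _))); rewrite big_distrl /=.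
  have pairs : #|{: {set 'I_n} * {set 'I_n}}| = (4 ^ n)%N.
    rewrite card_prod -finset.cardsT -powersetT card_powerset.
    by rewrite finset.cardsT card_ord -expnMn.
  rewrite -pairs -sum_nat_const [leqRHS](bigID admissible) /=.
  apply: leq_trans (leq_addr _ _); apply: leq_sum => p adm_p.
  by rewrite -expnMn leq_exp2r // Z_le.
have /fintype.subsetPn[y _ y_good] : ~~ ([set: {ffun 'I_k -> X}] \subset bad).
  by apply: contraL bad_lt => /subset_leq_card; rewrite finset.cardsT -leqNgt.
(* The good family is transposed: [y j] lists the [j]-th coordinates of all [n] vectors. *)
pose s := [tuple (\row_j v (y j i)) | i < n].
exists s; last first.
  by move=> i j; exists (y j i); rewrite ?ltn_ord // tnth_mktuple mxE.
move=> A1 A2 m1 m2 A12 E; move/negP: y_good; apply.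
apply/bigcupP; exists (A1, A2); first by rewrite /admissible m1 m2; apply/eqP.
rewrite inE; apply/ffun_onP => j; rewrite inE /=; apply/eqP.
rewrite -[RHS](evaluation_eq_multilinear j E).
by apply: eq_bigr => I _; congr (_ * _); apply: eq_bigr => i _;
  rewrite tnth_mktuple mxE.
Qed.

Theorem theorem4p3 (R : realType) (n k m : nat)
    (hn : (1 <= n)%N) (hk : (1 <= k)%N) (hm : (1 <= m)%N) :
  exists s : n.-tuple 'rV[int]_k,
    evaluation_distinct m s /\
    exists2 M : R, bounded_seq M s & M <= m%:R * (4 `^ (n%:R / k%:R)).
Proof.
set B : R := _ * _.
have B_ge0 : 0 <= B by rewrite mulr_ge0 ?powR_ge0.
have /andP[floor_le lt_floor] := truncn_itv B_ge0.
(* Here S is [(Num.truncn B).+1], which exceeds [B], and the [k]-th power of [B] is exactly m^k 4^n.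
   Entries below S are then at most [Num.truncn B], the bound M chosen below. *)
have large : (m ^ k * 4 ^ n < (Num.truncn B).+1 ^ k)%N.
  have Bk : B ^+ k = (m ^ k * 4 ^ n)%:R.
    rewrite exprMn natrM !natrX; congr (_ * _).
    rewrite -!powR_mulrn ?powR_ge0 // -powRrM divfK //.
    by rewrite pnatr_eq0 -lt0n.
  by rewrite -(ltr_nat R) -Bk natrX ltrXn2r // -lt0n.
have [s s_distinct s_bounded] := exists_evaluation_distinct hk hm large.
exists s; split => //; exists (Num.truncn B)%:R => // i j.
have [a a_le ->] := s_bounded i j.
by rewrite ler0n ler_nat.
Qed.
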